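(* Let $d\ge 1$, let $h:[0,+\infty)\times\mathbb{R}^d\to\mathbb{R}$, and let $\hat R(\xi)=[\hat R_{pq}(\xi)]_{p,q=1,\dots,d}$, $\xi\in\mathbb{R}^d$, be a complex matrix valued function whose trace $\hat r(\xi):=\operatorname{tr}\hat R(\xi)$ is non-negative and integrable on $\mathbb{R}^d$. Put $\mathfrak{r}(d\xi):=\hat r(\xi)\,d\xi$, and assume that for $\mathfrak{r}$-a.e. $\xi$ the matrix $\hat R(\xi)$ is Hermitian ($\hat R_{pq}(\xi)=\overline{\hat R_{qp}(\xi)}$, $p,q=1,\dots,d$) and non-negative definite ($\hat R(\xi)\eta\cdot\eta\ge 0$ for all $\eta\in\mathbb{C}^d$). Define $$R_{pq}(t,x)=\int_{\mathbb{R}^d}e^{ix\cdot\xi}\,h(|t|,\xi)\,\hat R_{pq}(\xi)\,d\xi,\qquad p,q=1,\dots,d,\ (t,x)\in\mathbb{R}^{1+d}.$$ Then the following are equivalent: (i) for any $N\ge 1$, $\alpha_1,\dots,\alpha_N\in\mathbb{C}$ and $t_1,\dots,t_N\in\mathbb{R}$, $$\sum_{p,q=1}^N h(|t_p-t_q|,\xi)\,\alpha_p\bar\alpha_q\ge 0\qquad\text{for }\mathfrak{r}\text{-a.e. }\xi;$$ (ii) the matrix valued function $R(t,x)=[R_{pq}(t,x)]_{p,q=1,\dots,d}$ is non-negative definite.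
   Context: The functions $h(|t|,\cdot)$ and $\hat R_{pq}$ are measurable, and $h(|t|,\cdot)\,\hat r(\cdot)$ is integrable on $\mathbb{R}^d$ for each $t$, so that the integrals defining $R_{pq}(t,x)$ are well defined. $\hat R_{pq}$ is the density of the (Hermitian matrix valued) spectral measure, which is absolutely continuous with respect to $\mathfrak{r}$, i.e. $\hat R(\xi)=A(\xi)\hat r(\xi)$ with $A(\xi)$ non-negative Hermitian and $\operatorname{tr}A(\xi)=1$ for $\mathfrak{r}$-a.e. $\xi$. For $a,b\in\mathbb{C}^d$, $a\cdot b$ in expressions such as $\hat R(\xi)\eta\cdot\eta$ denotes the Hermitian inner product $\sum_p a_p\bar b_p$. The matrix valued function $R$ on $\mathbb{R}^{1+d}$ is called non-negative definite if for all $N\ge 1$, all points $(t_1,x_1),\dots,(t_N,x_N)\in\mathbb{R}^{1+d}$ and all vectors $a_1,\dots,a_N\in\mathbb{C}^d$, with $a_j=(a_{j,1},\dots,a_{j,d})$, $$\sum_{j,k=1}^N\sum_{p,q=1}^d R_{pq}(t_j-t_k,x_j-x_k)\,a_{j,p}\,\overline{a_{k,q}}\ge 0.$$ *)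

(* Defs.v *)
From HB Require Import structures.
From mathcomp Require Import all_boot all_order all_algebra.
From mathcomp Require Import all_classical all_reals all_analysis.
From mathcomp Require Import complex.

Set Implicit Arguments.
Unset Strict Implicit.
Unset Printing Implicit Defensive.
Import Order.TTheory GRing.Theory Num.Theory.
Import numFieldNormedType.Exports.

Local Open Scope classical_set_scope.
Local Open Scope complex_scope.
Local Open Scope ring_scope.

(* R^d with its Borel sigma-algebra (generated by the coordinate maps) *)
Notation Rvec R d := (d.-tuple (measurableTypeR R)).

Section euclidean_space.
Context {R : realType} {d : nat}.
Implicit Types x y xi : Rvec R d.

Definition vsub x y : Rvec R d := [tuple (tnth x i - tnth y i : R) | i < d].

Definition dot x xi : R := \sum_(i < d) (tnth x i : R) * (tnth xi i : R).

End euclidean_space.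

Section cons_measure.
Local Open Scope ereal_scope.
Context {R : realType} (n : nat).
Variable mu : {sigma_finite_measure set (Rvec R n) -> \bar R}.

Definition cons_pair (p : measurableTypeR R * Rvec R n) : Rvec R n.+1 :=
  [tuple of p.1 :: p.2].

Lemma measurable_cons_pair : measurable_fun [set: _] cons_pair.
Proof. exact: measurable_cons. Qed.

HB.instance Definition _ :=
  @isMeasurableFun.Build _ _ _ _ cons_pair measurable_cons_pair.

Definition cons_measure : set (Rvec R n.+1) -> \bar R :=
  pushforward (@lebesgue_measure R \x mu) cons_pair.

Let cons_measure0 : cons_measure set0 = 0.
Proof. exact: measure0. Qed.

Let cons_measure_ge0 A : 0 <= cons_measure A.
Proof. exact: measure_ge0. Qed.

Let cons_measure_sigma_additive : semi_sigma_additive cons_measure.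
Proof. exact: measure_semi_sigma_additive. Qed.

HB.instance Definition _ := isMeasure.Build _ _ _ cons_measure
  cons_measure0 cons_measure_ge0 cons_measure_sigma_additive.

Lemma cons_measureX (A : set (measurableTypeR R)) (B : set (Rvec R n)) :
  measurable A -> measurable B ->
  cons_measure [set u | A (thead u) /\ B [tuple of behead u]] =
  lebesgue_measure A * mu B.
Proof.
move=> mA mB; rewrite -product_measure1E// /cons_measure /pushforward.
congr (product_measure1 _ _ _); apply/seteqP.
have behK (p : measurableTypeR R * Rvec R n) :
  [tuple of behead (cons_pair p)] = p.2 by exact: val_inj.
by split => p /=; rewrite behK.
Qed.

Let cons_measure_sigma_finite : sigma_finite [set: Rvec R n.+1] cons_measure.
Proof.
have /sigma_finiteP[F [UF ndF mF]] := sigma_finiteT (@lebesgue_measure R).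
have /sigma_finiteP[G [UG ndG mG]] := sigma_finiteT mu.
exists (fun i => [set u : Rvec R n.+1 |
    F i (thead u) /\ G i [tuple of behead u]]).
  apply/seteqP; split => // u _.
  have [i _ Fi] : (\bigcup_i F i) (thead u) by rewrite -UF.
  have [j _ Gj] : (\bigcup_i G i) [tuple of behead u] by rewrite -UG.
  exists (maxn i j) => //; split.
    by move: Fi; apply/subsetPset/ndF/leq_maxl.
  by move: Gj; apply/subsetPset/ndG/leq_maxr.
move=> i; have [mFi Fioo] := mF i; have [mGi Gioo] := mG i; split.
  apply: measurableI; rewrite -[X in measurable X]setTI.
    exact: (measurable_tnth ord0).
  exact: measurable_behead.
by rewrite cons_measureX// lte_mul_pinfty// ge0_fin_numE.
Qed.

HB.instance Definition _ := Measure_isSigmaFinite.Build _ _ _ cons_measure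
  cons_measure_sigma_finite.

End cons_measure.

(* Lebesgue measure on R^d, as the d-fold product of the one on R *)
Fixpoint lebesgueRd (R : realType) (d : nat) :
    {sigma_finite_measure set (Rvec R d) -> \bar R} :=
  if d is n.+1 then cons_measure (lebesgueRd R n)
  else \d_([tuple] : Rvec R 0).
Arguments lebesgueRd {R} d.

Lemma lebesgueRd_box (R : realType) (d : nat)
    (A : 'I_d -> set (measurableTypeR R)) : (forall i, measurable (A i)) ->
  lebesgueRd d [set x | forall i, A i (tnth x i)] =
  (\prod_(i < d) lebesgue_measure (A i))%E.
Proof.
elim: d A => [|n IH] A mA.
  rewrite big_ord0 /= diracE mem_set//=.
  by case.
rewrite big_ord_recl -IH => [|i]; last exact: mA.
rewrite -product_measure1E//=.
  rewrite /cons_measure /pushforward; congr (product_measure1 _ _ _).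
  apply/seteqP; split => -[a u]/=.
    move=> H; split; first exact: (H ord0).
    by move=> i; have := H (lift ord0 i); rewrite tnthS.
  move=> [Aa Au] i; case: (unliftP ord0 i) => [j ->|->//].
  by rewrite tnthS.
rewrite (_ : [set _ | _] =
    \bigcap_(i in [set: 'I_n]) ((@tnth n _)^~ i @^-1` A (lift ord0 i))).
  apply: fin_bigcap_measurable => // i _.
  by rewrite -[X in measurable X]setTI; exact: measurable_tnth.
by apply/seteqP; split => [u H i _|u H i]; exact: H.
Qed.

Section complex_integral.
Context d (T : measurableType d) (R : realType).
Variable mu : {measure set T -> \bar R}.

Definition cmeasurable (f : T -> R[i]) : Prop :=
  measurable_fun [set: T] (fun x => complex.Re (f x)) /\
  measurable_fun [set: T] (fun x => complex.Im (f x)).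

Definition cintegral (f : T -> R[i]) : R[i] :=
  (\int[mu]_x complex.Re (f x)) +i* (\int[mu]_x complex.Im (f x)).

End complex_integral.

Definition expi {R : realType} (theta : R) : R[i] := cos theta +i* sin theta.

Section matrices.
Context {R : realType} {d : nat}.
Implicit Types (M : 'M[R[i]]_d) (a b : 'cV[R[i]]_d).

Definition hdot a b : R[i] := \sum_(p < d) a p 0 * (b p 0)^*.

Definition hermitian_mx M : Prop := forall p q, M p q = (M q p)^*.

Definition nonneg_definite_mx M : Prop :=
  forall eta : 'cV[R[i]]_d, 0 <= hdot (M *m eta) eta.

End matrices.

Section spectral_density.
Context {R : realType} {d : nat}.
Variable Rhat : Rvec R d -> 'M[R[i]]_d.

(* no information is lost by taking the real part: in R[i], [0 <= z] means that z
   is real and non-negative, and this is assumed of the trace *)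
Definition rhat (xi : Rvec R d) : R := complex.Re (\tr (Rhat xi)).

Definition spectral_trace_measure (A : set (Rvec R d)) : \bar R :=
  (\int[lebesgueRd d]_(xi in A) (rhat xi)%:E)%E.

(* The matrix measure Rhat(xi) dxi has a density A with respect to its trace
   measure. Hermitian and non-negative definite values of Rhat almost everywhere
   for the trace measure would leave Rhat unconstrained where rhat vanishes. *)
Definition trace_density (A : Rvec R d -> 'M[R[i]]_d) : Prop :=
  {ae lebesgueRd d, forall xi, Rhat xi = (rhat xi)%:C *: A xi} /\
  {ae spectral_trace_measure, forall xi,
    [/\ hermitian_mx (A xi), nonneg_definite_mx (A xi) & \tr (A xi) = 1]}.

Definition spectral_covariance (h : R -> Rvec R d -> R) (t : R) (x : Rvec R d) :
    'M[R[i]]_d :=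
  \matrix_(p, q) cintegral (lebesgueRd d)
    (fun xi => expi (dot x xi) * (h `|t| xi)%:C * Rhat xi p q).

End spectral_density.

Definition nonneg_definite_fun {R : realType} {d : nat}
    (K : R -> Rvec R d -> 'M[R[i]]_d) : Prop :=
  forall N : nat, (0 < N)%N ->
  forall (t : 'I_N -> R) (x : 'I_N -> Rvec R d) (a : 'I_N -> 'cV[R[i]]_d),
    0 <= \sum_(j < N) \sum_(k < N) \sum_(p < d) \sum_(q < d)
      K (t j - t k) (vsub (x j) (x k)) p q * a j p 0 * (a k q 0)^*.

(* Main.v *)
Require Import Defs.
From mathcomp Require Import all_boot all_order all_algebra.
From mathcomp Require Import all_classical all_reals all_analysis.
From mathcomp Require Import measurable_realfun complex spectral sesquilinear.
From mathcomp Require Import ring lra.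
Import Order.TTheory GRing.Theory Num.Theory.
Import numFieldNormedType.Exports.

Local Open Scope classical_set_scope.
Local Open Scope complex_scope.
Local Open Scope ring_scope.

Set Implicit Arguments.
Unset Strict Implicit.
Unset Printing Implicit Defensive.

(** Write [H xi] for the kernel [(s, t) |-> h (|s - t|, xi)]. The quadratic form
    of the covariance at points [(t_j, x_j)] with vectors [a_j] is the integral
    over [xi] of
      [\sum_(j, k) \sum_(p, q)
         h (|t_j - t_k|, xi) Rhat_pq (xi) b_(j,p) (b_(k,q))^*]
    with [b_j = e^(i x_j . xi) a_j] ([covariance_form]). The equivalence
    compares the sign of this integral with the sign of its integrand.

    If (i) holds, then for almost every [xi] the form of [H xi] is non-negative
    for all complex coefficients simultaneously: rational coefficients give
    countably many exceptional null sets, and the other coefficients follow by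
    continuity ([temporal_form_ae_all]). This uniformity is needed because the
    Schur product argument of [schur_product_ge0] feeds [H xi] with coefficients
    that depend on [xi], namely combinations of the [b_j] with the eigenvectors
    of [Rhat xi]. The integrand is then non-negative almost everywhere where the
    trace [rhat] is positive, and vanishes almost everywhere elsewhere.

    Conversely, fix [alpha] and [t], and let [g (xi)] be [rhat (xi)] times the
    form in (i). Testing (ii) at the points [(t_j, x_m)] with the vectors
    [alpha_j c_m e_r], and summing over the basis vectors [e_r], gives
      [0 <= \int |\sum_m c_m e^(i x_m . xi)|^2 g (xi) d xi]
    for every trigonometric polynomial. What remains is to deduce [0 <= g]
    almost everywhere ([ge0_ae_of_trig_poly]). The inequality
    [0 <= \int f^2 g] survives bounded pointwise limits in [f] by dominated
    convergence, so it holds on the smallest class which contains the real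
    trigonometric polynomials and is closed under such limits. This class is an
    algebra, hence the sets whose indicators it contains form a sigma-algebra;
    that sigma-algebra contains the half-spaces, since [sg (xi_i - a)] is the
    limit of [sg (sin ((xi_i - a) / n))] and the sign function on [[-1, 1]] is
    itself a limit of polynomials. Thus every Borel set is reached, in
    particular [{g < 0}]. *)

(** * Non-negative definite matrices *)

(** The vectors are the eigenvectors, scaled by square roots of the
    eigenvalues. *)
Lemma psd_sum_rank1 (C : numClosedFieldType) (n : nat) (M : 'M[C]_n) :
    (forall p q, M p q = (M q p)^*) ->
    (forall eta : 'cV[C]_n, 0 <= \sum_p (M *m eta) p 0 * (eta p 0)^*) ->
  exists v : 'I_n -> 'I_n -> C, forall p q, M p q = \sum_l v l p * (v l q)^*.
Proof.
move=> Mherm Mpsd.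
have /hermitian_normalmx/orthomx_spectralP : M \is hermitianmx _ false Num.conj.
  apply/is_hermitianmxP/matrixP => p q.
  by rewrite expr0 scale1r !mxE Mherm.
have Punit := spectral_unitarymx M.
rewrite invmx_unitary //.
set P := spectralmx M; set D := spectral_diag M => MPD.
have PM : P *m M *m map_mx Num.conj P^T = diag_mx D.
  have PP : P *m map_mx Num.conj P^T = 1%:M by apply/unitarymxP.
  by rewrite MPD !mulmxA PP mul1mx -mulmxA PP mulmx1.
have D_ge0 l : 0 <= D 0 l.
  have := Mpsd (\col_q (P l q)^*).
  have -> : D 0 l = diag_mx D l l by rewrite mxE eqxx mulr1n.
  rewrite -PM -mulmxA mxE; congr (0 <= _); apply: eq_bigr => p _.
  rewrite mxE conjCK mulrC !mxE; congr (_ * _); apply: eq_bigr => q _.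
  by rewrite !mxE.
exists (fun l p => sqrtC (D 0 l) * (P l p)^*) => p q.
rewrite {1}MPD mxE; apply: eq_bigr => l _.
rewrite mul_mx_diag !mxE rmorphM /=.
have -> : ((P l q)^*)^* = P l q by exact: conjCK.
have -> : (sqrtC (D 0 l))^* = sqrtC (D 0 l).
  by apply/conj_Creal/ger0_real; rewrite sqrtC_ge0.
by rewrite mulrACA -expr2 sqrtCK mulrCA mulrA.
Qed.

(** Splitting [M] into rank one matrices turns the double form into a sum over
    [l] of forms of [H], with coefficients [\sum_p v l p * b j p]. *)
Lemma schur_product_ge0 (C : numClosedFieldType) (I : finType) (n : nat)
    (H : I -> I -> C) (M : 'M[C]_n) (b : I -> 'I_n -> C) :
    (forall c : I -> C, 0 <= \sum_j \sum_k H j k * c j * (c k)^*) ->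
    (forall p q, M p q = (M q p)^*) ->
    (forall eta : 'cV[C]_n, 0 <= \sum_p (M *m eta) p 0 * (eta p 0)^*) ->
  0 <= \sum_j \sum_k \sum_p \sum_q H j k * M p q * b j p * (b k q)^*.
Proof.
move=> Hpsd Mherm Mpsd.
have [v Mv] := psd_sum_rank1 Mherm Mpsd.
suff -> : \sum_j \sum_k \sum_p \sum_q H j k * M p q * b j p * (b k q)^* =
    \sum_l \sum_j \sum_k H j k * (\sum_p v l p * b j p) *
                           (\sum_q v l q * b k q)^*.
  by apply: sumr_ge0 => l _; exact: Hpsd.
rewrite [RHS]exchange_big; apply: eq_bigr => j _.
rewrite [RHS]exchange_big; apply: eq_bigr => k _.
under [RHS]eq_bigr => l _.
  rewrite mulr_sumr mulr_suml.
  under eq_bigr => p _ do rewrite rmorph_sum mulr_sumr.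
  over.
rewrite [RHS]exchange_big; apply: eq_bigr => p _.
rewrite [RHS]exchange_big; apply: eq_bigr => q _.
rewrite Mv mulr_sumr !mulr_suml; apply: eq_bigr => l _ /=.
rewrite rmorphM; ring.
Qed.

(** With [M p q = \sum_l v l p * (v l q)^*], the inequality
    [2 |x| |y| <= |x|^2 + |y|^2] bounds an entry by the mean of two diagonal
    ones. *)
Lemma psd_entry_le_trace (C : numClosedFieldType) (n : nat) (M : 'M[C]_n) :
    (forall p q, M p q = (M q p)^*) ->
    (forall eta : 'cV[C]_n, 0 <= \sum_p (M *m eta) p 0 * (eta p 0)^*) ->
  forall p q, `|M p q| <= \tr M.
Proof.
move=> Mherm Mpsd p q.
have [v Mv] := psd_sum_rank1 Mherm Mpsd.
have diag_ge0 r : 0 <= M r r.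
  by rewrite Mv sumr_ge0// => l _; rewrite -normCK exprn_ge0.
have diag_le r : M r r <= \tr M.
  by rewrite /mxtrace (bigD1 r)//= lerDl sumr_ge0.
suff : `|M p q| *+ 2 <= M p p + M q q.
  move=> /le_trans /(_ (lerD (diag_le p) (diag_le q))).
  by rewrite -mulr2n lerMn2r.
have -> : M p p + M q q = \sum_l (`|v l p| ^+ 2 + `|v l q| ^+ 2).
  rewrite big_split !Mv.
  by congr (_ + _); apply: eq_bigr => l _; rewrite normCK.
rewrite Mv; apply: le_trans (_ : (\sum_l `|v l p| * `|v l q|) *+ 2 <= _).
  rewrite lerMn2r/=; apply: le_trans (ler_norm_sum _ _ _) _.
  by apply: ler_sum => l _; rewrite normrM norm_conjC.
rewrite -sumrMnl; apply: ler_sum => l _.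
rewrite -subr_ge0; have -> : `|v l p| ^+ 2 + `|v l q| ^+ 2 -
  `|v l p| * `|v l q| *+ 2 = (`|v l p| - `|v l q|) ^+ 2 by ring.
by rewrite real_exprn_even_ge0// rpredB// normr_real.
Qed.

(** * Complex-valued integrals *)

Section complex_parts.
Context {R : realType}.
Implicit Types z w : R[i].

Lemma Re_addc z w : complex.Re (z + w) = complex.Re z + complex.Re w.
Proof. by case: z w => [a b] []. Qed.

Lemma Im_addc z w : complex.Im (z + w) = complex.Im z + complex.Im w.
Proof. by case: z w => [a b] []. Qed.

Lemma Re_mulc z w : complex.Re (z * w) =
  complex.Re z * complex.Re w - complex.Im z * complex.Im w.
Proof. by case: z w => [a b] []. Qed.

Lemma Im_mulc z w : complex.Im (z * w) =
  complex.Re z * complex.Im w + complex.Im z * complex.Re w.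
Proof. by case: z w => [a b] []. Qed.

Lemma Re_sumc (I : Type) (s : seq I) (F : I -> R[i]) :
  complex.Re (\sum_(i <- s) F i) = \sum_(i <- s) complex.Re (F i).
Proof. by apply: big_morph => // z w; rewrite Re_addc. Qed.

Lemma Im_sumc (I : Type) (s : seq I) (F : I -> R[i]) :
  complex.Im (\sum_(i <- s) F i) = \sum_(i <- s) complex.Im (F i).
Proof. by apply: big_morph => // z w; rewrite Im_addc. Qed.

Lemma complexP z w :
  complex.Re z = complex.Re w -> complex.Im z = complex.Im w -> z = w.
Proof. by case: z w => [a b] [c d] /= -> ->. Qed.

Lemma complex_ge0P z : (0 <= z) <-> (complex.Im z = 0 /\ 0 <= complex.Re z).
Proof.
rewrite lecE; split; first by case/andP => /eqP.
by case=> -> ->; rewrite eqxx.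
Qed.

End complex_parts.

Section trigonometric_functions.
Context {R : realType}.

Lemma norm_cos_le1 (u : R) : `|cos u| <= 1.
Proof. by rewrite ler_norml cos_geN1 cos_le1. Qed.

Lemma norm_sin_le1 (u : R) : `|sin u| <= 1.
Proof. by rewrite ler_norml sin_geN1 sin_le1. Qed.

Lemma measurable_cos : measurable_fun [set: R] (cos : R -> R).
Proof. by apply: continuous_measurable_fun; exact: continuous_cos. Qed.

Lemma measurable_sin : measurable_fun [set: R] (sin : R -> R).
Proof. by apply: continuous_measurable_fun; exact: continuous_sin. Qed.

End trigonometric_functions.

Section complex_integrals.
Context d (T : measurableType d) (R : realType).
Variable mu : {measure set T -> \bar R}.
Local Notation integrableT f := (mu.-integrable [set: T] (EFin \o f)).

Lemma ae_le_integrable (f g : T -> R) :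
    measurable_fun [set: T] f -> integrableT g ->
    {ae mu, forall x, `|f x| <= g x} -> integrableT f.
Proof.
move=> mf ig fg.
have mEf : measurable_fun [set: T] (EFin \o f) by exact/measurable_EFinP.
have [mEg goo] := integrableP _ _ _ ig.
apply/integrableP; split => //; apply: le_lt_trans goo.
apply: ae_ge0_le_integral => //.
- exact: measurableT_comp.
- exact: measurableT_comp.
apply: filterS fg => x /= fgx _.
by rewrite lee_fin (le_trans fgx)// ler_norm.
Qed.

Definition cintegrable (f : T -> R[i]) : Prop :=
  integrableT (fun x => complex.Re (f x)) /\
  integrableT (fun x => complex.Im (f x)).

Lemma integrable_add (f g : T -> R) : integrableT f -> integrableT g ->
  integrableT (fun x => f x + g x).
Proof. by move=> fi gi; exact: (integrableD measurableT fi gi). Qed.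

Lemma integrable_scale (k : R) (f : T -> R) : integrableT f ->
  integrableT (fun x => k * f x).
Proof. by move=> fi; exact: (integrableZl measurableT k fi). Qed.

Lemma cintegrableD f g : cintegrable f -> cintegrable g ->
  cintegrable (fun x => f x + g x).
Proof.
move=> [fr fi] [gr gi]; split.
  under [X in EFin \o X]eq_fun do rewrite Re_addc.
  exact: integrable_add.
under [X in EFin \o X]eq_fun do rewrite Im_addc.
exact: integrable_add.
Qed.

Lemma cintegralD f g : cintegrable f -> cintegrable g ->
  cintegral mu (fun x => f x + g x) = cintegral mu f + cintegral mu g.
Proof.
move=> [fr fi] [gr gi]; apply: complexP; rewrite /cintegral /=.
  under eq_Rintegral do rewrite Re_addc.
  by rewrite RintegralD.
under eq_Rintegral do rewrite Im_addc.
by rewrite RintegralD.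
Qed.

Lemma cintegrableZ (c : R[i]) f : cintegrable f ->
  cintegrable (fun x => c * f x).
Proof.
move=> [fr fi]; split.
  under [X in EFin \o X]eq_fun do rewrite Re_mulc -mulNr.
  by apply: integrable_add; exact: integrable_scale.
under [X in EFin \o X]eq_fun do rewrite Im_mulc.
by apply: integrable_add; exact: integrable_scale.
Qed.

Lemma cintegralZ (c : R[i]) f : cintegrable f ->
  cintegral mu (fun x => c * f x) = c * cintegral mu f.
Proof.
move=> [fr fi]; apply: complexP; rewrite ?Re_mulc ?Im_mulc /cintegral /=.
  under eq_Rintegral do rewrite Re_mulc -mulNr.
  rewrite RintegralD //; try exact: integrable_scale.
  by rewrite !RintegralZl // mulNr.
under eq_Rintegral do rewrite Im_mulc.
rewrite RintegralD //; try exact: integrable_scale.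
by rewrite !RintegralZl.
Qed.

Lemma cintegral0 : cintegral mu (fun=> 0) = 0.
Proof. by apply: complexP; rewrite /cintegral /Rintegral /= integral0. Qed.

Lemma cintegrable0 : cintegrable (fun=> 0).
Proof. by split; exact: integrable0. Qed.

Lemma cintegrable_sum (I : Type) (s : seq I) (F : I -> T -> R[i]) :
  (forall i, cintegrable (F i)) -> cintegrable (fun x => \sum_(i <- s) F i x).
Proof.
move=> Fi; elim: s => [|i s IH].
  by under eq_fun do rewrite big_nil; exact: cintegrable0.
by under eq_fun do rewrite big_cons; exact: cintegrableD.
Qed.

Lemma cintegral_sum (I : Type) (s : seq I) (F : I -> T -> R[i]) :
  (forall i, cintegrable (F i)) ->
  cintegral mu (fun x => \sum_(i <- s) F i x) =
  \sum_(i <- s) cintegral mu (F i).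
Proof.
move=> Fi; elim: s => [|i s IH].
  by under eq_fun do rewrite big_nil; rewrite big_nil cintegral0.
under eq_fun do rewrite big_cons.
by rewrite cintegralD// ?IH ?big_cons//; exact: cintegrable_sum.
Qed.

Lemma Rintegral_ae_ge0 (f : T -> R) : measurable_fun [set: T] f ->
  {ae mu, forall x, 0 <= f x} -> 0 <= \int[mu]_x f x.
Proof.
move=> mf f0; rewrite /Rintegral.
have mEf : measurable_fun [set: T] (EFin \o f) by exact/measurable_EFinP.
rewrite (@ae_eq_integral _ _ _ mu _ (fun x => `|(f x)%:E|)%E) //.
- by rewrite fine_ge0// integral_ge0.
- exact: measurableT_comp.
- by apply: filterS f0 => x /= f0 _; rewrite ger0_norm.
Qed.

Lemma cintegral_ae_ge0 f : cintegrable f ->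
  {ae mu, forall x, 0 <= f x} -> 0 <= cintegral mu f.
Proof.
move=> [/integrableP[/measurable_EFinP fr _] /integrableP[fi _]] f0.
apply/complex_ge0P; split => /=; last first.
  by apply: Rintegral_ae_ge0 => //; apply: filterS f0 => x /complex_ge0P[].
rewrite /Rintegral (@ae_eq_integral _ _ _ mu _ (cst 0%E)) ?integral0//.
by apply: filterS f0 => x /complex_ge0P[/= -> _] _.
Qed.

Lemma integrable_boundedM (u f : T -> R) :
  measurable_fun [set: T] u -> (forall x, `|u x| <= 1) ->
  integrableT f -> integrableT (fun x => u x * f x).
Proof.
move=> mu1 u1 fi; apply: (integrableMr measurableT mu1 _ fi).
exists 1; split => // y y1 x _ /=.
exact: le_trans (u1 x) (ltW y1).
Qed.

Lemma cintegrable_expiM (theta : T -> R) f : measurable_fun [set: T] theta ->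
  cintegrable f -> cintegrable (fun x => expi (theta x) * f x).
Proof.
move=> mtheta [fr fi].
have mcos : measurable_fun [set: T] (fun x => cos (theta x)).
  exact: measurableT_comp measurable_cos mtheta.
have msin : measurable_fun [set: T] (fun x => sin (theta x)).
  exact: measurableT_comp measurable_sin mtheta.
have cos1 x : `|cos (theta x)| <= 1 by exact: norm_cos_le1.
have sin1 x : `|sin (theta x)| <= 1 by exact: norm_sin_le1.
split.
  under [X in EFin \o X]eq_fun do rewrite Re_mulc -mulrN.
  apply: integrable_add; first exact: integrable_boundedM.
  apply: integrable_boundedM => //.
  by under [X in EFin \o X]eq_fun do rewrite -mulN1r; exact: integrable_scale.
under [X in EFin \o X]eq_fun do rewrite Im_mulc.
by apply: integrable_add; exact: integrable_boundedM.
Qed.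

End complex_integrals.

Lemma ae_forall_countable d (T : measurableType d) (R : realType)
    (mu : {measure set T -> \bar R}) (I : countType) (P : I -> T -> Prop) :
  (forall i, {ae mu, forall x, P i x}) -> {ae mu, forall x, forall i, P i x}.
Proof.
move=> Pae.
have : {ae mu, forall x, forall n, forall i : I, unpickle n = Some i -> P i x}.
  apply: ae_foralln => n; case: (unpickle n) => [i|]; last exact: aeW.
  by apply: filterS (Pae i) => x Pix _ [<-].
by apply: filterS => x Px i; apply: (Px (pickle i)); rewrite pickleK.
Qed.

(** * From rational to complex coefficients *)

Section psd_density.
Context {R : realType} {I : finType}.

Lemma psd_of_rational (H : I -> I -> R) :
    (forall u : I -> rat, 0 <= \sum_j \sum_k H j k * ratr (u j) * ratr (u k)) ->
  forall w : I -> R, 0 <= \sum_j \sum_k H j k * w j * w k.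
Proof.
move=> Hrat w.
have [u uP] : {u : nat -> I -> rat |
    forall n j, w j - n.+1%:R^-1 < ratr (u n j) < w j}.
  suff S n j : {q : rat | w j - n.+1%:R^-1 < ratr q < w j}.
    by exists (fun n j => projT1 (S n j)) => n j; exact: projT2 (S n j).
  apply: cid; have [|q] := @rat_in_itvoo R (w j - n.+1%:R^-1) (w j).
    by rewrite ltrBlDr ltrDl invr_gt0 ltr0n.
  by rewrite in_itv/= => qP; exists q.
have ucvg j : (ratr (u n j) : R) @[n --> \oo] --> w j.
  apply: (@squeeze_cvgr _ _ _ _ (fun n => w j - n.+1%:R^-1) (cst (w j))).
  - by apply: nearW => n; have /andP[? ?] := uP n j; rewrite !ltW.
  - rewrite -[X in _ --> X]subr0; apply: cvgB; first exact: cvg_cst.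
    exact: cvg_harmonic.
  - exact: cvg_cst.
have Qcvg : (\sum_j \sum_k H j k * ratr (u n j) * ratr (u n k)) @[n --> \oo]
    --> \sum_j \sum_k H j k * w j * w k.
  apply: cvg_big => [|j _]; first exact: add_continuous.
  apply: cvg_big => [|k _]; first exact: add_continuous.
  by apply: cvgM => //; apply: cvgM => //; exact: cvg_cst.
by apply: (cvgr_to_ge Qcvg); apply: nearW.
Qed.

(** Exchanging the two summation indices conjugates the form. *)
Lemma Im_symmetric_form (H : I -> I -> R) (c : I -> R[i]) :
    (forall j k, H j k = H k j) ->
  complex.Im (\sum_j \sum_k (H j k)%:C * c j * (c k)^*) = 0.
Proof.
move=> Hsym; set S := complex.Im _.
suff : S = - S by lra.
rewrite {1}/S exchange_big /S !Im_sumc -sumrN; apply: eq_bigr => j _.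
rewrite !Im_sumc -sumrN; apply: eq_bigr => k _.
rewrite Hsym; case: (c j) => a b; case: (c k) => a' b' /=; ring.
Qed.

(** For a real symmetric kernel the form of [u +i* v] is the sum of the forms of
    [u] and [v]. *)
Lemma psd_complex (H : I -> I -> R) (c : I -> R[i]) :
    (forall j k, H j k = H k j) ->
    (forall w : I -> R, 0 <= \sum_j \sum_k H j k * w j * w k) ->
  0 <= \sum_j \sum_k (H j k)%:C * c j * (c k)^*.
Proof.
move=> Hsym Hpsd; apply/complex_ge0P; split; first exact: Im_symmetric_form.
have -> : complex.Re (\sum_j \sum_k (H j k)%:C * c j * (c k)^*) =
    \sum_j \sum_k H j k * complex.Re (c j) * complex.Re (c k) +
    \sum_j \sum_k H j k * complex.Im (c j) * complex.Im (c k).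
  rewrite Re_sumc -big_split; apply: eq_bigr => j _.
  rewrite Re_sumc -big_split; apply: eq_bigr => k _.
  by case: (c j) => a b; case: (c k) => a' b' /=; ring.
by rewrite addr_ge0.
Qed.

End psd_density.

(** * Bounded pointwise limits *)

Section sign_iteration.
Context {R : realType}.
Implicit Types u : R.

(** On [[-1, 1]] the fixed points of this odd cubic are [-1], [0] and [1]; [0]
    repels and the others attract, so that its iterates are polynomials
    converging to the sign function. *)
Definition sign_step u : R := u * (3 - u ^+ 2) / 2.

Lemma sign_step_itv u : `|u| <= 1 -> `|sign_step u| <= 1.
Proof.
rewrite !ler_norml /sign_step => /andP[ge_u le_u].
have h1 : 0 <= (1 - u) ^+ 2 * (2 + u) by rewrite mulr_ge0 ?sqr_ge0//; lra.
have h2 : 0 <= (1 + u) ^+ 2 * (2 - u) by rewrite mulr_ge0 ?sqr_ge0//; lra.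
by apply/andP; split; nra.
Qed.

Lemma iter_sign_stepN n u : iter n sign_step (- u) = - iter n sign_step u.
Proof. by elim: n => //= n ->; rewrite /sign_step; ring. Qed.

(** The gap to [1] shrinks geometrically, because
    [1 - sign_step v = (1 - v / 2 - v ^+ 2 / 2) * (1 - v)] and the iterates stay
    above [u]. *)
Lemma iter_sign_step_ge n u : 0 < u -> u <= 1 ->
  [/\ u <= iter n sign_step u, iter n sign_step u <= 1 &
      1 - iter n sign_step u <= (1 - u / 2) ^+ n].
Proof.
move=> u0 u1; elim: n => [|n [geu le1 gap]]; first by split => //=; lra.
rewrite iterS; move: geu le1 gap; set v := iter n _ _ => geu le1 gap.
have uv : u <= sign_step v.
  apply: (le_trans geu); rewrite /sign_step.
  have : 0 <= v * (1 - v) * (1 + v) by rewrite !mulr_ge0//; lra.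
  by nra.
have v1 : sign_step v <= 1.
  suff : 0 <= (1 - v) ^+ 2 * (2 + v) by rewrite /sign_step; nra.
  by rewrite mulr_ge0 ?sqr_ge0//; lra.
split => //; rewrite exprS.
have -> : 1 - sign_step v = (1 - v / 2 - v ^+ 2 / 2) * (1 - v).
  by rewrite /sign_step; field.
have v2 : v ^+ 2 <= 1 by nra.
by apply: ler_pM => //; nra.
Qed.

Lemma cvg_iter_sign_step u : `|u| <= 1 ->
  iter n sign_step u @[n --> \oo] --> Num.sg u.
Proof.
have pos v : 0 < v -> v <= 1 -> iter n sign_step v @[n --> \oo] --> (1 : R).
  move=> v0 v1.
  apply: (@squeeze_cvgr _ _ _ _ (fun n => 1 - (1 - v / 2) ^+ n) (cst 1)).
  - by apply: nearW => n; have [_ le1 gap] := iter_sign_step_ge n v0 v1;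
      apply/andP; split => //=; lra.
  - rewrite -[X in _ --> X]subr0; apply: cvgB; first exact: cvg_cst.
    by apply: cvg_expr; rewrite ger0_norm; lra.
  - exact: cvg_cst.
rewrite ler_norml => /andP[ge_u le_u].
have [u0|u0|<-] := ltgtP 0 u.
- by rewrite gtr0_sg//; exact: pos.
- rewrite ltr0_sg// -[u]opprK.
  under eq_fun do rewrite iter_sign_stepN.
  by apply: cvgN; apply: pos; lra.
- rewrite sgr0; apply: cvg_near_cst; apply: nearW.
  by elim=> //= n ->; rewrite /sign_step mul0r mul0r.
Qed.

End sign_iteration.

Section bounded_limits.
Context {T : Type} {R : realType}.
Variable A : (T -> R) -> Prop.

(** The closure is inductive rather than sequential: a limit of limits of
    elements of [A] need not be a limit of a sequence in [A]. *)
Inductive bounded_limit : (T -> R) -> Prop :=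
| bounded_limit_base f : A f -> bounded_limit f
| bounded_limit_step (F : nat -> T -> R) (M : R) f :
    (forall n, bounded_limit (F n)) -> (forall n x, `|F n x| <= M) ->
    (forall x, F n x @[n --> \oo] --> f x) -> bounded_limit f.

Hypothesis A_bounded : forall f, A f -> exists M, forall x, `|f x| <= M.
Hypothesis A_cst : forall c, A (cst c).
Hypothesis A_add : forall f g, A f -> A g -> A (fun x => f x + g x).
Hypothesis A_mul : forall f g, A f -> A g -> A (fun x => f x * g x).

Lemma bounded_limit_bounded f :
  bounded_limit f -> exists M, forall x, `|f x| <= M.
Proof.
elim=> [{}f /A_bounded//|F M {}f _ _ FM Ff].
exists M => x.
have nFf : (`|F n x| : R) @[n --> \oo] --> `|f x| by exact: cvg_norm.
by apply: (cvgr_to_le nFf); near=> n.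
Unshelve. all: by end_near. Qed.

Lemma bounded_limit_cst c : bounded_limit (cst c).
Proof. exact: bounded_limit_base. Qed.

Lemma bounded_limit_add f g : bounded_limit f -> bounded_limit g ->
  bounded_limit (fun x => f x + g x).
Proof.
move=> fl gl; elim: fl => [{}f Af|F M {}f _ IH FM Ff].
  elim: gl => [{}g Ag|G N {}g _ IH GN Gg].
    exact/bounded_limit_base/A_add.
  have [M fM] := A_bounded Af.
  apply: (@bounded_limit_step (fun n x => f x + G n x) (M + N)) => // [n x|x].
    by rewrite (le_trans (ler_normD _ _))// lerD.
  by apply: cvgD => //; exact: cvg_cst.
have [N gN] := bounded_limit_bounded gl.
apply: (@bounded_limit_step (fun n x => F n x + g x) (M + N)) => // [n x|x].
  by rewrite (le_trans (ler_normD _ _))// lerD.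
by apply: cvgD => //; exact: cvg_cst.
Qed.

Lemma bounded_limit_mul f g : bounded_limit f -> bounded_limit g ->
  bounded_limit (fun x => f x * g x).
Proof.
move=> fl gl; elim: fl => [{}f Af|F M {}f _ IH FM Ff].
  elim: gl => [{}g Ag|G N {}g _ IH GN Gg].
    exact/bounded_limit_base/A_mul.
  have [M fM] := A_bounded Af.
  apply: (@bounded_limit_step (fun n x => f x * G n x) (M * N)) => // [n x|x].
    by rewrite normrM ler_pM.
  by apply: cvgM => //; exact: cvg_cst.
have [N gN] := bounded_limit_bounded gl.
apply: (@bounded_limit_step (fun n x => F n x * g x) (M * N)) => // [n x|x].
  by rewrite normrM ler_pM.
by apply: cvgM => //; exact: cvg_cst.
Qed.

Lemma eq_bounded_limit f g :
  f =1 g -> bounded_limit f -> bounded_limit g.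
Proof. by move=> /funext ->. Qed.

Lemma bounded_limit_oneB f : bounded_limit f ->
  bounded_limit (fun x => 1 - f x).
Proof.
move=> fl.
apply: (@eq_bounded_limit (fun x => cst 1 x + cst (-1) x * f x)).
  by move=> x /=; rewrite mulN1r.
apply: bounded_limit_add; first exact: bounded_limit_cst.
by apply: bounded_limit_mul => //; exact: bounded_limit_cst.
Qed.

Lemma bounded_limit_setC (E : set T) :
  bounded_limit \1_E -> bounded_limit \1_(~` E).
Proof.
move=> /bounded_limit_oneB; apply: eq_bounded_limit => x.
by rewrite !indicE in_setC; case: (x \in E); rewrite ?subrr ?subr0.
Qed.

Lemma bounded_limit_setU (E F : set T) : bounded_limit \1_E ->
  bounded_limit \1_F -> bounded_limit \1_(E `|` F).
Proof.
move=> /bounded_limit_oneB El /bounded_limit_oneB Fl.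
have := bounded_limit_oneB (bounded_limit_mul El Fl).
apply: eq_bounded_limit => x; rewrite !indicE in_setU.
by case: (x \in E); case: (x \in F) => /=; ring.
Qed.

(** Complements and finite unions come from the algebra structure, and countable
    unions are limits of finite ones. *)
Lemma bounded_limit_sigma_algebra :
  sigma_algebra [set: T] [set E | bounded_limit \1_E].
Proof.
split => [|E /=|E /= El].
- by apply: eq_bounded_limit (bounded_limit_cst 0) => x; rewrite indic0.
- by rewrite setTD; exact: bounded_limit_setC.
have Ul n : bounded_limit \1_(\bigcup_(k < n) E k).
  elim: n => [|n IH].
    rewrite bigcup_mkord big_ord0.
    by apply: eq_bounded_limit (bounded_limit_cst 0) => x; rewrite indic0.
  rewrite bigcup_mkord big_ord_recr/= -bigcup_mkord.
  exact: bounded_limit_setU.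
apply: (@bounded_limit_step _ 1 _ Ul) => [n x|x].
  by rewrite indicE; case: (_ \in _); rewrite ?normr1 ?normr0.
have [[k _ Ekx]|nEx] := pselect ((\bigcup_k E k) x).
  apply: cvg_near_cst; near=> n.
  rewrite !indicE !mem_set//; first by exists k.
  by exists k => //=; near: n; exists k.+1.
apply: cvg_near_cst; near=> n.
rewrite !indicE !memNset//.
by move=> [k _ Ekx]; apply: nEx; exists k.
Unshelve. all: by end_near. Qed.

Lemma bounded_limit_sgr f : bounded_limit f -> (forall x, `|f x| <= 1) ->
  bounded_limit (fun x => Num.sg (f x)).
Proof.
move=> fl f1.
pose F n x := iter n sign_step (f x).
have F1 n x : `|F n x| <= 1.
  by elim: n => [|n IH]; [exact: f1|exact: sign_step_itv].
apply: (@bounded_limit_step F 1) => // [|x]; last exact: cvg_iter_sign_step.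
elim=> [|n IH]; first exact: eq_bounded_limit fl.
have sq := bounded_limit_mul IH IH.
have cub := bounded_limit_mul IH sq.
apply: (@eq_bounded_limit
  (fun x => cst (3 / 2) x * F n x + cst (- 2^-1) x * (F n x * (F n x * F n x)))).
  by move=> x; rewrite /F iterS /sign_step/=; field.
by apply: bounded_limit_add; apply: bounded_limit_mul => //;
  exact: bounded_limit_cst.
Qed.

End bounded_limits.

Section bounded_limit_integral.
Context d (T : measurableType d) (R : realType).
Variable mu : {measure set T -> \bar R}.
Variable g : T -> R.
Hypothesis gi : mu.-integrable [set: T] (EFin \o g).
Variable A : (T -> R) -> Prop.
Hypothesis A_measurable : forall f, A f -> measurable_fun [set: T] f.
Hypothesis A_bounded : forall f, A f -> exists M, forall x, `|f x| <= M.

Lemma bounded_limit_measurable f :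
  bounded_limit A f -> measurable_fun [set: T] f.
Proof.
elim=> [{}f /A_measurable//|F M {}f _ mF _ Ff].
by apply: (measurable_fun_cvg mF) => x _; exact: Ff.
Qed.

(** Dominated convergence, with dominating function [M ^+ 2 * `|g x|]. The square
    allows [A] to be an algebra, whose elements have no sign. *)
Lemma bounded_limit_integral_ge0 :
  (forall f, A f -> 0 <= \int[mu]_x (f x ^+ 2 * g x)) ->
  forall f, bounded_limit A f -> 0 <= \int[mu]_x (f x ^+ 2 * g x).
Proof.
move=> Age0 f; elim=> [{}f /Age0//|F M {}f Fl IH FM Ff].
have fl : bounded_limit A f by exact: bounded_limit_step FM Ff.
have mg : measurable_fun [set: T] g.
  by apply/measurable_EFinP; case/integrableP: gi.
have mFg u : bounded_limit A u ->
    measurable_fun [set: T] (fun x => (u x ^+ 2 * g x)%:E).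
  move=> ul; apply/measurable_EFinP/measurable_funM => //.
  by apply: measurable_funX; exact: bounded_limit_measurable.
have dom n x : `|F n x ^+ 2 * g x| <= M ^+ 2 * `|g x|.
  rewrite normrM normrX.
  by rewrite ler_wpM2r// lerXn2r// nnegrE// (le_trans _ (FM n x)).
have [_ _ Fg] : [/\ mu.-integrable setT (fun x => (f x ^+ 2 * g x)%:E),
   (\int[mu]_x `|(F n x ^+ 2 * g x)%:E - (f x ^+ 2 * g x)%:E|)%E
     @[n --> \oo] --> 0%E &
   (\int[mu]_x (F n x ^+ 2 * g x)%:E)%E @[n --> \oo] -->
   (\int[mu]_x (f x ^+ 2 * g x)%:E)%E].
  apply: (@dominated_convergence _ _ _ mu _ measurableT _ _
     (fun x => (M ^+ 2 * `|g x|)%:E)).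
  - by move=> n; exact: mFg.
  - exact: mFg.
  - apply: aeW => x _; apply: cvg_EFin; first exact: nearW.
    apply: cvgM; last exact: cvg_cst.
    by apply: cvgM; exact: Ff.
  - apply: integrable_scale; exact: integrable_norm.
  - by apply: aeW => x n _; rewrite lee_fin.
rewrite /Rintegral fine_ge0//.
apply: (cvge_to_ge Fg); apply: nearW => n.
suff fin : (\int[mu]_x (F n x ^+ 2 * g x)%:E \is a fin_num)%E.
  by rewrite -(fineK fin) lee_fin; exact: IH.
apply: integrable_fin_num => //.
apply: (@ae_le_integrable _ _ _ mu _ (fun x => M ^+ 2 * `|g x|)).
- exact/measurable_EFinP/mFg.
- by apply: integrable_scale; exact: integrable_norm.
- exact: aeW.
Qed.

End bounded_limit_integral.

(** * Trigonometric polynomials *)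

Section trigonometric_polynomials.
Context {R : realType} {d : nat}.
Implicit Types x y xi : Rvec R d.

Lemma expiD (a b : R) : expi (a + b) = expi a * expi b.
Proof.
apply: complexP; rewrite /expi ?Re_mulc ?Im_mulc /= ?cosD ?sinD //.
by rewrite addrC mulrC.
Qed.

Lemma expi0 : expi 0 = 1 :> R[i].
Proof. by apply: complexP; rewrite /expi /= ?cos0 ?sin0. Qed.

Lemma conj_expi (a : R) : (expi a)^* = expi (- a).
Proof. by apply: complexP; rewrite /expi /= ?cosN ?sinN. Qed.

Definition vadd x y : Rvec R d := [tuple (tnth x i + tnth y i : R) | i < d].

Lemma dot_vadd x y xi : dot (vadd x y) xi = dot x xi + dot y xi.
Proof.
by rewrite -big_split; apply: eq_bigr => i _; rewrite tnth_mktuple mulrDl.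
Qed.

Lemma dot_vsub x y xi : dot (vsub x y) xi = dot x xi - dot y xi.
Proof.
by rewrite -sumrB; apply: eq_bigr => i _; rewrite tnth_mktuple mulrBl.
Qed.

Definition axis_vec (i : 'I_d) (c : R) : Rvec R d :=
  [tuple (if j == i then c else 0 : R) | j < d].

Lemma dot_axis_vec i c xi : dot (axis_vec i c) xi = c * tnth xi i.
Proof.
rewrite /dot (bigD1 i)//= tnth_mktuple eqxx big1 ?addr0// => j /negPf ji.
by rewrite tnth_mktuple ji mul0r.
Qed.

Lemma measurable_dot x : measurable_fun [set: Rvec R d] (dot x).
Proof.
apply: measurable_sum => i; apply: measurable_funM => //.
exact: measurable_tnth.
Qed.

Definition trig_sum (s : seq (R[i] * Rvec R d)) xi : R[i] :=
  \sum_(p <- s) p.1 * expi (dot p.2 xi).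

Definition real_trig_poly (f : Rvec R d -> R) : Prop :=
  exists s, forall xi, (f xi)%:C = trig_sum s xi.

Lemma real_trig_poly_Re f s : (forall xi, (f xi)%:C = trig_sum s xi) ->
  f = fun xi => \sum_(p <- s) complex.Re (p.1 * expi (dot p.2 xi)).
Proof.
move=> fs; apply/funext => xi.
by rewrite -Re_sumc -[RHS]/(complex.Re (trig_sum s xi)) -fs.
Qed.

Lemma real_trig_poly_measurable f :
  real_trig_poly f -> measurable_fun [set: Rvec R d] f.
Proof.
move=> [s /real_trig_poly_Re ->]; apply: measurable_sum => p.
under eq_fun do rewrite Re_mulc.
apply: measurable_funB; apply: measurable_funM => //=.
  exact: measurableT_comp measurable_cos (measurable_dot _).
exact: measurableT_comp measurable_sin (measurable_dot _).
Qed.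

Lemma real_trig_poly_bounded f :
  real_trig_poly f -> exists M, forall xi, `|f xi| <= M.
Proof.
move=> [s /real_trig_poly_Re ->].
exists (\sum_(p <- s) (`|complex.Re p.1| + `|complex.Im p.1|)) => xi.
apply: le_trans (ler_norm_sum _ _ _) _; apply: ler_sum => p _.
rewrite Re_mulc (le_trans (ler_normB _ _))//= !normrM.
by apply: lerD; rewrite ler_piMr ?norm_cos_le1 ?norm_sin_le1.
Qed.

Lemma real_trig_poly_cst c : real_trig_poly (cst c).
Proof.
(* the frequency is the zero vector *)
exists [:: (c%:C, vsub [tuple 0 | i < d] [tuple 0 | i < d])] => xi.
by rewrite /trig_sum big_seq1 /= dot_vsub subrr expi0 mulr1.
Qed.

Lemma real_trig_polyD f g : real_trig_poly f -> real_trig_poly g ->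
  real_trig_poly (fun xi => f xi + g xi).
Proof.
move=> [s fs] [t gt]; exists (s ++ t) => xi.
by rewrite rmorphD /= fs gt /trig_sum big_cat.
Qed.

Lemma real_trig_polyM f g : real_trig_poly f -> real_trig_poly g ->
  real_trig_poly (fun xi => f xi * g xi).
Proof.
move=> [s fs] [t gt].
exists [seq (p.1 * q.1, vadd p.2 q.2) | p <- s, q <- t] => xi.
rewrite rmorphM /= fs gt /trig_sum big_distrlr /= big_allpairs_dep.
apply: eq_bigr => p _; apply: eq_bigr => q _ /=.
by rewrite dot_vadd expiD mulrACA.
Qed.

Lemma real_trig_poly_sin (i : 'I_d) (c b : R) :
  real_trig_poly (fun xi => sin (c * tnth xi i - b)).
Proof.
(* [sin u = (e^(i u) - e^(- i u)) / (2 i)] with [u = c * xi_i - b] *)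
exists [:: ((0 +i* (- 2^-1)) * expi (- b), axis_vec i c);
           ((0 +i* 2^-1) * expi b, axis_vec i (- c))] => xi.
rewrite /trig_sum !big_cons big_nil addr0 /= -!mulrA -!expiD !dot_axis_vec.
have -> : b + - c * tnth xi i = - (- b + c * tnth xi i) by ring.
rewrite [c * _ - b]addrC; set u := - b + _.
by apply: complexP;
  rewrite /expi ?Re_addc ?Im_addc ?Re_mulc ?Im_mulc /= ?cosN ?sinN; field.
Qed.

Lemma sgr_sin (u : R) : `|u| <= 1 -> Num.sg (sin u) = Num.sg u.
Proof.
have pi1 : 1 < (pi : R) by apply: lt_le_trans (pi_ge2 R); rewrite ltr1n.
have pos (v : R) : 0 < v -> v <= 1 -> Num.sg (sin v) = 1.
  move=> v0 v1; rewrite gtr0_sg//; apply: sin_gt0_pi.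
  by rewrite v0/= (le_lt_trans v1).
rewrite ler_norml => /andP[ge_u le_u].
have [u0|u0|<-] := ltgtP 0 u.
- by rewrite pos// (gtr0_sg u0).
- rewrite (ltr0_sg u0) -[u]opprK sinN sgrN pos//; lra.
- by rewrite sin0.
Qed.

(** For fixed [xi] and large [n] the angle [(xi_i - a) / n.+1] lies in [[-1, 1]],
    where the sine has the sign of its argument: scaling the angle down removes
    the periodicity, and the sequence is eventually constant. *)
Lemma bounded_limit_halfspace (i : 'I_d) (a : R) :
  bounded_limit real_trig_poly \1_[set xi : Rvec R d | a < tnth xi i].
Proof.
have sgl : bounded_limit real_trig_poly
    (fun xi : Rvec R d => Num.sg (tnth xi i - a)).
  pose F n (xi : Rvec R d) : R :=
    Num.sg (sin (n.+1%:R^-1 * tnth xi i - n.+1%:R^-1 * a)).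
  have F1 n xi : `|F n xi| <= 1.
    by rewrite /F normr_sg; case: (_ == _); rewrite ?lexx ?ler01.
  apply: (bounded_limit_step _ F1) => [n|xi].
    apply: bounded_limit_sgr.
    - exact: real_trig_poly_bounded.
    - exact: real_trig_poly_cst.
    - exact: real_trig_polyD.
    - exact: real_trig_polyM.
    - by apply: bounded_limit_base; exact: real_trig_poly_sin.
    - by move=> xi; exact: norm_sin_le1.
  apply: cvg_near_cst; near=> n.
  have n0 : 0 < n.+1%:R^-1 :> R by rewrite invr_gt0 ltr0n.
  rewrite /F -mulrBr sgr_sin; first by rewrite sgrM gtr0_sg// mul1r.
  rewrite normrM gtr0_norm// mulrC ler_pdivrMr ?ltr0n// mul1r.
  apply: (@le_trans _ _ n%:R); last by rewrite ler_nat.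
  near: n; exact: nbhs_infty_ger.
(* the indicator is [(s ^+ 2 + s) / 2] for [s = sg (xi_i - a)] *)
have sq := bounded_limit_mul (@real_trig_poly_bounded)
  (@real_trig_polyM) sgl sgl.
have sum := bounded_limit_add (@real_trig_poly_bounded)
  (@real_trig_polyD) sq sgl.
have := bounded_limit_mul (@real_trig_poly_bounded) (@real_trig_polyM)
  (bounded_limit_cst (@real_trig_poly_cst) 2^-1) sum.
apply: eq_bounded_limit => xi; rewrite indicE /=.
have [axi|xia|axi] := ltgtP a (tnth xi i).
- have -> : Num.sg (tnth xi i - a) = 1 by rewrite gtr0_sg ?subr_gt0.
  by rewrite mem_set//=; field.
- have -> : Num.sg (tnth xi i - a) = -1 by rewrite ltr0_sg ?subr_lt0.
  rewrite memNset/=; first by ring.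
  by apply/negP; rewrite -leNgt ltW.
- rewrite memNset/=; first by rewrite axi subrr sgr0; ring.
  by apply/negP; rewrite -leNgt axi.
Unshelve. all: by end_near. Qed.

(** The Borel sets of [R^d] are generated by the coordinate preimages of Borel
    sets of [R], and these by the half-lines. *)
Lemma measurable_bounded_limit (E : set (Rvec R d)) : measurable E ->
  bounded_limit real_trig_poly \1_E.
Proof.
have SA : sigma_algebra setT [set E | bounded_limit real_trig_poly \1_E].
  apply: bounded_limit_sigma_algebra.
  - exact: real_trig_poly_bounded.
  - exact: real_trig_poly_cst.
  - exact: real_trig_polyD.
  - exact: real_trig_polyM.
have [SA0 SAC SAU] := SA.
move: E; apply: (@smallest_sub _ _ _
  [set E | bounded_limit real_trig_poly \1_E]) => // F.
rewrite -bigcup_seq => -[i _ [B mB <-]].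
have {mB} : (@RGenOInfty.G R).-sigma.-measurable B.
  by rewrite -RGenOInfty.measurableE.
rewrite setTI; move: B.
apply: (@smallest_sub _ _ _ [set B | bounded_limit real_trig_poly
    \1_((fun x : Rvec R d => tnth x i) @^-1` B)]).
  split=> [|B /= Bl|B Bl] /=.
  - by rewrite preimage_set0.
  - by rewrite setTD preimage_setC -setTD; exact: SAC.
  - by rewrite preimage_bigcup; exact: SAU.
move=> _ [a ->] /=.
have -> : (fun x : Rvec R d => tnth x i) @^-1` `]a, +oo[%classic =
    [set xi : Rvec R d | a < tnth xi i].
  by apply/seteqP; split => xi /=; rewrite in_itv/= andbT.
exact: bounded_limit_halfspace.
Qed.

End trigonometric_polynomials.

(** The indicator of [{g < 0}] lies in the closure of the real trigonometric
    polynomials under bounded limits, so the integral of [g] over this set is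
    non-negative. *)
Lemma ge0_ae_of_trig_poly (R : realType) (d : nat)
    (mu : {measure set (Rvec R d) -> \bar R}) (g : Rvec R d -> R) :
    mu.-integrable [set: Rvec R d] (EFin \o g) ->
    (forall f, real_trig_poly f -> 0 <= \int[mu]_xi (f xi ^+ 2 * g xi)) ->
  {ae mu, forall xi, 0 <= g xi}.
Proof.
move=> gi gpos.
have mg : measurable_fun [set: Rvec R d] g.
  by apply/measurable_EFinP; case/integrableP: gi.
pose E := [set xi | g xi < 0].
have mE : measurable E.
  rewrite [E](_ : _ = [set: _] `&` g @^-1` `]-oo, 0[%classic).
    exact: mg.
  by rewrite setTI; apply/seteqP; split => xi /=; rewrite in_itv.
have : 0 <= \int[mu]_xi ((\1_E xi : R) ^+ 2 * g xi).
  apply: (@bounded_limit_integral_ge0 _ _ _ mu g gi real_trig_poly) => //.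
  - exact: real_trig_poly_measurable.
  - exact: measurable_bounded_limit.
(* [g] is negative on [E], so [- \1_E * g] is a non-negative function with a
   non-positive integral *)
pose u xi : R := - ((\1_E xi : R) ^+ 2 * g xi).
have u_ge0 xi : 0 <= u xi.
  rewrite /u indicE; have [|] := boolP (xi \in E).
    by rewrite inE /E /= => /ltW; rewrite expr1n mul1r oppr_ge0.
  by rewrite expr0n mul0r oppr0.
have ui : mu.-integrable [set: Rvec R d] (EFin \o u).
  have mE1 : measurable_fun [set: Rvec R d] (\1_E : _ -> R).
    exact: measurable_indic.
  have -> : EFin \o u = EFin \o (fun xi => - (\1_E xi : R) ^+ 2 * g xi).
    by apply/funext => xi /=; rewrite /u mulNr.
  apply: integrable_boundedM => //.
    by apply: measurable_funN; exact: measurable_funX.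
  move=> xi; rewrite normrN indicE.
  by case: (xi \in E); rewrite ?expr1n ?expr0n/= ?normr1 ?normr0.
have -> : \int[mu]_xi ((\1_E xi : R) ^+ 2 * g xi) = - \int[mu]_xi u xi.
  rewrite -mulN1r -RintegralZl//; apply: eq_Rintegral => xi _.
  by rewrite /u mulN1r opprK.
rewrite oppr_ge0 => u_le0.
have int_u : (\int[mu]_xi `|(u xi)%:E|)%E = 0%E.
  under eq_integral do rewrite gee0_abs ?lee_fin//.
  have fin : (\int[mu]_xi (u xi)%:E)%E \is a fin_num.
    exact: integrable_fin_num.
  rewrite -(fineK fin); congr (_%:E); apply/eqP; rewrite eq_le u_le0/=.
  by apply: Rintegral_ge0.
have := (ae_eq_integral_abs mu measurableT (measurable_int _ ui)).1 int_u.
apply: filterS => xi /(_ I) [] /eqP.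
rewrite /u oppr_eq0 indicE.
have [xiE|] := boolP (xi \in E).
  by rewrite expr1n mul1r => /eqP ->.
move=> /negP xiE _; rewrite leNgt; apply/negP => gxi.
by apply: xiE; rewrite inE.
Qed.

(** * The spectral density and its covariance *)

Section spectral_measure.
Context {R : realType} {d : nat}.
Variables (h : R -> Rvec R d -> R) (Rhat : Rvec R d -> 'M[R[i]]_d).
Hypothesis Rhat_measurable : forall p q, cmeasurable (fun xi => Rhat xi p q).
Hypothesis trace_ge0 : forall xi, 0 <= \tr (Rhat xi).
Local Notation mu := (lebesgueRd d).
Local Notation r := (rhat Rhat).

Lemma rhat_ge0 xi : 0 <= r xi.
Proof. by have /complex_ge0P[] := trace_ge0 xi. Qed.

Lemma trace_rhat xi : \tr (Rhat xi) = (r xi)%:C.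
Proof. by have /complex_ge0P[I0 _] := trace_ge0 xi; exact: complexP. Qed.

Lemma measurable_rhat : measurable_fun [set: Rvec R d] r.
Proof.
have -> : r = fun xi => \sum_(p < d) complex.Re (Rhat xi p p).
  by apply/funext => xi; rewrite /rhat Re_sumc.
by apply: measurable_sum => p; exact: (Rhat_measurable p p).1.
Qed.

Let mErhat (A : set (Rvec R d)) :
  measurable A -> measurable_fun A (fun xi => (r xi)%:E).
Proof.
move=> mA; apply/measurable_EFinP; apply: measurable_funTS.
exact: measurable_rhat.
Qed.

(** Reduces almost everywhere statements for the measure [rhat xi d xi] to
    Lebesgue measure: the zero set of [rhat] is null for the former, and on its
    complement the two measures have the same null sets. *)
Lemma spectral_aeP (P : Rvec R d -> Prop) :
  {ae spectral_trace_measure Rhat, forall xi, P xi} <->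
  {ae mu, forall xi, 0 < r xi -> P xi}.
Proof.
split.
  move=> [A [mA rA0 nPA]].
  have : (\int[mu]_(xi in A) `|(r xi)%:E|)%E = 0%E.
    rewrite -[RHS]rA0; apply: eq_integral => xi _.
    by rewrite gee0_abs// lee_fin rhat_ge0.
  move=> /(ae_eq_integral_abs mu mA (mErhat mA)); apply: filterS => xi rxi r0.
  apply: contrapT => nP; have [r0'] : (r xi)%:E = 0%:E := rxi (nPA _ nP).
  by rewrite r0' ltxx in r0.
move=> [N [mN muN nPN]].
pose Z := [set xi | r xi = 0].
have mZ : measurable Z.
  rewrite [Z](_ : _ = [set: _] `&` r @^-1` [set 0]); last by rewrite setTI.
  exact: measurable_rhat.
exists (N `|` Z); split; first exact: measurableU.
  rewrite /spectral_trace_measure.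
  under eq_integral do rewrite -[(r _)%:E]gee0_abs ?lee_fin ?rhat_ge0//.
  apply/ae_eq_integral_abs; first exact: measurableU.
    by apply: mErhat; exact: measurableU.
  exists N; split => // xi /= nxi; apply: contrapT => nN; apply: nxi.
  by move=> [//|-> //].
move=> xi /= nP; have [r0|r0] := eqVneq (r xi) 0; first by right.
left; apply: nPN => /= H; apply: nP; apply: H.
by rewrite lt_def r0 rhat_ge0.
Qed.

Hypothesis h_measurable : forall t : R, measurable_fun [set: Rvec R d] (h `|t|).
Hypothesis h_rhat_integrable : forall t : R,
  mu.-integrable [set: Rvec R d] (fun xi => (h `|t| xi * r xi)%:E).
Hypothesis Rhat_density : exists A, trace_density Rhat A.
Hypothesis Rhat_hermitian :
  {ae spectral_trace_measure Rhat, forall xi, hermitian_mx (Rhat xi)}.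
Hypothesis Rhat_nonneg :
  {ae spectral_trace_measure Rhat, forall xi, nonneg_definite_mx (Rhat xi)}.

(** The density with respect to the trace measure makes [Rhat] vanish where
    [rhat] does, so the pointwise properties hold almost everywhere for Lebesgue
    measure and not just on [0 < rhat]. *)
Lemma Rhat_ae : {ae mu, forall xi,
  [/\ hermitian_mx (Rhat xi), nonneg_definite_mx (Rhat xi) &
      r xi = 0 -> Rhat xi = 0]}.
Proof.
have [A [RA _]] := Rhat_density.
move/spectral_aeP : Rhat_hermitian; move/spectral_aeP : Rhat_nonneg.
apply: filterS3 RA => xi RxiA nn herm.
have [r0|r0] := eqVneq (r xi) 0.
  have -> : Rhat xi = 0 by rewrite RxiA r0 scale0r.
  split=> // [p q|eta]; first by rewrite !mxE conjC0.
  by rewrite mul0mx /hdot big1// => p _; rewrite mxE mul0r.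
have rpos : 0 < r xi by rewrite lt_def r0 rhat_ge0.
by split; [exact: herm|exact: nn|move/eqP; rewrite (negPf r0)].
Qed.

Lemma Rhat_entry_ae p q : {ae mu, forall xi,
  `|complex.Re (Rhat xi p q)| <= r xi /\ `|complex.Im (Rhat xi p q)| <= r xi}.
Proof.
apply: filterS Rhat_ae => xi [herm nn _].
have := psd_entry_le_trace herm nn p q; rewrite trace_rhat => le_r.
split; first by have := le_trans (normc_ge_Re _) le_r; rewrite lecR.
(* the imaginary part of [z] is minus the real part of [z * 'i] *)
have := normc_ge_Re (Rhat xi p q * 'i%C).
rewrite ReiNIm normrN normrM complexiE normCi mulr1 => /le_trans /(_ le_r).
by rewrite lecR.
Qed.

Lemma cintegrable_h_Rhat (t : R) p q :
  cintegrable mu (fun xi => (h `|t| xi)%:C * Rhat xi p q).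
Proof.
have [mRe mIm] := Rhat_measurable p q.
have ihr : mu.-integrable [set: Rvec R d]
    (fun xi => `|h `|t| xi * r xi|%:E).
  by apply: integrable_norm; exact: h_rhat_integrable.
split; cbv beta.
  under [X in EFin \o X]eq_fun do rewrite Re_mulc /= mul0r subr0.
  apply: ae_le_integrable ihr _; first exact: measurable_funM.
  apply: filterS (Rhat_entry_ae p q) => xi [le_r _].
  by rewrite !normrM ler_wpM2l// (le_trans le_r)// ler_norm.
under [X in EFin \o X]eq_fun do rewrite Im_mulc /= mul0r addr0.
apply: ae_le_integrable ihr _; first exact: measurable_funM.
apply: filterS (Rhat_entry_ae p q) => xi [_ le_r].
by rewrite !normrM ler_wpM2l// (le_trans le_r)// ler_norm.
Qed.

Section form.
Context {I : finType}.
Variables (t : I -> R) (x : I -> Rvec R d) (a : I -> 'cV[R[i]]_d).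

(** The integrand of the quadratic form of the covariance, with the exponentials
    absorbed in the vectors: in this shape it is a Schur product form. *)
Definition spectral_form (xi : Rvec R d) : R[i] :=
  \sum_j \sum_k \sum_(p < d) \sum_(q < d)
    (h `|t j - t k| xi)%:C * Rhat xi p q *
    (expi (dot (x j) xi) * a j p 0) * (expi (dot (x k) xi) * a k q 0)^*.

(* the terms as they come from [spectral_covariance], constants in front *)
Let summand j k p q (xi : Rvec R d) : R[i] :=
  (a j p 0 * (a k q 0)^*) * (expi (dot (vsub (x j) (x k)) xi) *
     ((h `|t j - t k| xi)%:C * Rhat xi p q)).

Let summand_integrable j k p q : cintegrable mu (summand j k p q).
Proof.
apply: cintegrableZ; apply: cintegrable_expiM; first exact: measurable_dot.
exact: cintegrable_h_Rhat.
Qed.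

Let spectral_formE xi :
  spectral_form xi = \sum_j \sum_k \sum_p \sum_q summand j k p q xi.
Proof.
apply: eq_bigr => j _; apply: eq_bigr => k _.
apply: eq_bigr => p _; apply: eq_bigr => q _.
by rewrite /summand dot_vsub expiD -conj_expi rmorphM /=; ring.
Qed.

Lemma cintegrable_spectral_form : cintegrable mu spectral_form.
Proof.
rewrite (funext spectral_formE).
by do 4! apply: cintegrable_sum => ?.
Qed.

Lemma covariance_form :
  \sum_j \sum_k \sum_(p < d) \sum_(q < d)
    spectral_covariance Rhat h (t j - t k) (vsub (x j) (x k)) p q *
      a j p 0 * (a k q 0)^* = cintegral mu spectral_form.
Proof.
rewrite (funext spectral_formE).
rewrite cintegral_sum; last by move=> ?; do 3! apply: cintegrable_sum => ?.
apply: eq_bigr => j _.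
rewrite cintegral_sum; last by move=> ?; do 2! apply: cintegrable_sum => ?.
apply: eq_bigr => k _.
rewrite cintegral_sum; last by move=> ?; apply: cintegrable_sum => ?.
apply: eq_bigr => p _.
rewrite cintegral_sum//; apply: eq_bigr => q _.
rewrite cintegralZ; last first.
  apply: cintegrable_expiM; first exact: measurable_dot.
  exact: cintegrable_h_Rhat.
rewrite mxE -mulrA mulrC; congr (_ * cintegral _ _).
by apply/funext => xi; rewrite mulrA.
Qed.

End form.

End spectral_measure.

(** * The two implications *)

Lemma nonneg_definite_fun_finType (R : realType) (d : nat)
    (K : R -> Rvec R d -> 'M[R[i]]_d) (I : finType)
    (t : I -> R) (x : I -> Rvec R d) (a : I -> 'cV[R[i]]_d) :
  nonneg_definite_fun K ->
  0 <= \sum_j \sum_k \sum_(p < d) \sum_(q < d)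
    K (t j - t k) (vsub (x j) (x k)) p q * a j p 0 * (a k q 0)^*.
Proof.
move=> Kpos; have [I0|I0] := posnP #|I|.
  by rewrite big1// => j; have := fintype0 j I0.
have sumE (F : I -> R[i]) : \sum_i F i = \sum_(i < #|I|) F (enum_val i).
  by rewrite (reindex (@enum_val I I))//; exact/onW_bij/enum_val_bij.
rewrite sumE; under eq_bigr do rewrite sumE.
exact: (Kpos _ I0 (t \o enum_val) (x \o enum_val) (a \o enum_val)).
Qed.

Section characterization.
Context {R : realType} {d : nat}.
Variables (h : R -> Rvec R d -> R) (Rhat : Rvec R d -> 'M[R[i]]_d).
Hypothesis h_measurable : forall t : R, measurable_fun [set: Rvec R d] (h `|t|).
Hypothesis Rhat_measurable : forall p q, cmeasurable (fun xi => Rhat xi p q).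
Hypothesis trace_ge0 : forall xi, 0 <= \tr (Rhat xi).
Hypothesis h_rhat_integrable : forall t : R,
  (lebesgueRd d).-integrable [set: Rvec R d]
    (fun xi => (h `|t| xi * rhat Rhat xi)%:E).
Hypothesis Rhat_density : exists A, trace_density Rhat A.
Hypothesis Rhat_hermitian :
  {ae spectral_trace_measure Rhat, forall xi, hermitian_mx (Rhat xi)}.
Hypothesis Rhat_nonneg :
  {ae spectral_trace_measure Rhat, forall xi, nonneg_definite_mx (Rhat xi)}.
Local Notation mu := (lebesgueRd d).

Definition temporal_form {N : nat} (alpha : 'I_N -> R[i]) (t : 'I_N -> R)
    (xi : Rvec R d) : R[i] :=
  \sum_(p < N) \sum_(q < N) (h `|t p - t q| xi)%:C * alpha p * (alpha q)^*.

Lemma temporal_form_real N (alpha : 'I_N -> R[i]) t xi :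
  temporal_form alpha t xi = (complex.Re (temporal_form alpha t xi))%:C.
Proof.
apply: complexP => //=.
by apply: (Im_symmetric_form (H := fun p q => h `|t p - t q| xi)) => p q;
  rewrite distrC.
Qed.

(** The quantifiers over [alpha] and [xi] can be exchanged because countably many
    rational vectors suffice to decide non-negativity. *)
Lemma temporal_form_ae_all N (t : 'I_N -> R) :
    (forall alpha, {ae spectral_trace_measure Rhat, forall xi,
      0 <= temporal_form alpha t xi}) ->
  {ae mu, forall xi, 0 < rhat Rhat xi ->
    forall alpha, 0 <= temporal_form alpha t xi}.
Proof.
move=> Hae.
have : {ae mu, forall xi, forall u : {ffun 'I_N -> rat}, 0 < rhat Rhat xi ->
    0 <= temporal_form (fun j => (ratr (u j))%:C) t xi}.
  by apply: ae_forall_countable => u; apply/spectral_aeP.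
apply: filterS => xi Hrat r0 alpha; apply: psd_complex => [j k|w].
  by rewrite distrC.
apply: psd_of_rational => u.
have /complex_ge0P[_] := Hrat [ffun j => u j] r0.
rewrite /temporal_form Re_sumc; under eq_bigr do rewrite Re_sumc.
congr (0 <= _); apply: eq_bigr => j _; apply: eq_bigr => k _.
by rewrite !ffunE !Re_mulc !Im_mulc /=; ring.
Qed.

Lemma covariance_nonneg_definite :
    (forall N : nat, (0 < N)%N -> forall alpha (t : 'I_N -> R),
      {ae spectral_trace_measure Rhat, forall xi,
        0 <= temporal_form alpha t xi}) ->
  nonneg_definite_fun (spectral_covariance Rhat h).
Proof.
move=> Hpsd N N0 t x a.
rewrite covariance_form//; apply: cintegral_ae_ge0.
  exact: cintegrable_spectral_form.
have R_ae : {ae mu, forall xi, [/\ hermitian_mx (Rhat xi),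
  nonneg_definite_mx (Rhat xi) & rhat Rhat xi = 0 -> Rhat xi = 0]}.
  exact: Rhat_ae.
have := temporal_form_ae_all (Hpsd N N0 ^~ t).
apply: filterS2 R_ae => xi [herm nn Rhat0] H_psd.
have [r0|r0] := eqVneq (rhat Rhat xi) 0.
  rewrite /spectral_form Rhat0// big1// => j _; rewrite big1// => k _.
  rewrite big1// => p _; rewrite big1// => q _.
  by rewrite mxE mulr0 !mul0r.
apply: (schur_product_ge0 (H := fun j k => (h `|t j - t k| xi)%:C)
  (fun j p => expi (dot (x j) xi) * a j p 0) _ herm nn) => alpha.
by apply: H_psd; rewrite lt_def r0 rhat_ge0.
Qed.

Lemma temporal_form_ae_ge0 N (alpha : 'I_N -> R[i]) (t : 'I_N -> R) :
    nonneg_definite_fun (spectral_covariance Rhat h) ->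
  {ae spectral_trace_measure Rhat, forall xi, 0 <= temporal_form alpha t xi}.
Proof.
move=> Kpos; apply/(spectral_aeP Rhat_measurable trace_ge0).
pose g xi := complex.Re (temporal_form alpha t xi) * rhat Rhat xi.
have gi : mu.-integrable [set: Rvec R d] (EFin \o g).
  have -> : EFin \o g = fun xi => (\sum_(p < N) \sum_(q < N)
      (complex.Re (alpha p * (alpha q)^*) *
       (h `|t p - t q| xi * rhat Rhat xi))%:E)%E.
    apply/funext => xi; rewrite /= /g /temporal_form Re_sumc mulr_suml -sumEFin.
    apply: eq_bigr => p _; rewrite Re_sumc mulr_suml -sumEFin.
    apply: eq_bigr => q _; congr (_%:E).
    by rewrite -mulrA Re_mulc /= mul0r subr0; ring.
  apply: integrable_sum => // p _; apply: integrable_sum => // q _.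
  by apply: integrable_scale; exact: h_rhat_integrable.
suff : {ae mu, forall xi, 0 <= g xi}.
  apply: filterS => xi; rewrite /g => g0 r0.
  by rewrite temporal_form_real ler0c -(pmulr_lge0 _ r0).
apply: ge0_ae_of_trig_poly => // f [s fs].
(* The test points are the pairs of a time [t j] and a frequency vector of [f];
   the vector attached to them is [alpha j * c m] times the basis vector [r]. *)
pose I : finType := ('I_N * 'I_(size s))%type.
pose c (m : 'I_(size s)) := tnth (in_tuple s) m.
pose tI (i : I) := t i.1.
pose xI (i : I) := (c i.2).2.
pose aI (r : 'I_d) (i : I) : 'cV[R[i]]_d :=
  \col_p (if p == r then alpha i.1 * (c i.2).1 else 0).
(* the test vectors factor out [f ^+ 2 = (f%:C) * (f%:C)^*] *)
have formE r xi : spectral_form h Rhat tI xI (aI r) xi =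
    ((f xi) ^+ 2)%:C * temporal_form alpha t xi * Rhat xi r r.
  have sumI (F : I -> R[i]) : \sum_i F i = \sum_j \sum_m F (j, m).
    by rewrite (pair_bigA _ (fun j m => F (j, m))); apply: eq_bigr => -[].
  have fE : (f xi)%:C = \sum_m (c m).1 * expi (dot (c m).2 xi).
    by rewrite fs /trig_sum big_tnth.
  have fE' : (f xi)%:C = \sum_m ((c m).1 * expi (dot (c m).2 xi))^*.
    by rewrite -rmorph_sum -fE; exact: esym (conjc_real _).
  rewrite rmorphXn /= expr2 {1}fE fE' /temporal_form mulr_sumr mulr_suml.
  rewrite /spectral_form sumI; apply: eq_bigr => j _.
  under eq_bigr do rewrite sumI.
  rewrite exchange_big mulr_sumr mulr_suml; apply: eq_bigr => k _.
  rewrite !mulr_suml; apply: eq_bigr => m _.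
  rewrite mulr_sumr !mulr_suml; apply: eq_bigr => n _.
  rewrite (bigD1 r)//= [X in _ + X]big1 ?addr0; last first.
    move=> p /negPf pr; rewrite big1// => q _.
    by rewrite !mxE pr mulr0 mulr0 mul0r.
  rewrite (bigD1 r)//= [X in _ + X]big1 ?addr0; last first.
    by move=> q /negPf qr; rewrite !mxE qr mulr0 conjC0 mulr0.
  by rewrite !mxE eqxx !rmorphM /=; ring.
(* summing over the basis vectors [r] produces the trace *)
have : 0 <= \sum_(r < d) cintegral mu (spectral_form h Rhat tI xI (aI r)).
  apply: sumr_ge0 => r _; rewrite -covariance_form//.
  exact: nonneg_definite_fun_finType.
rewrite -cintegral_sum; last by move=> r; exact: cintegrable_spectral_form.
move=> /complex_ge0P[_] /=.
congr (0 <= _); apply: eq_Rintegral => xi _.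
under eq_bigr do rewrite formE.
rewrite -mulr_sumr -/(\tr (Rhat xi)) trace_rhat// temporal_form_real /g.
by rewrite -!rmorphM /= mulrA.
Qed.

End characterization.

Theorem proposition2p1 (R : realType) (d : nat) (hd : (0 < d)%N)
    (h : R -> Rvec R d -> R) (Rhat : Rvec R d -> 'M[R[i]]_d)
    (h_measurable : forall t : R, measurable_fun [set: Rvec R d] (h `|t|))
    (Rhat_measurable : forall p q, cmeasurable (fun xi => Rhat xi p q))
    (trace_ge0 : forall xi, 0 <= \tr (Rhat xi))
    (rhat_integrable :
      (lebesgueRd d).-integrable [set: Rvec R d] (fun xi => (rhat Rhat xi)%:E))
    (h_rhat_integrable : forall t : R,
      (lebesgueRd d).-integrable [set: Rvec R d]
        (fun xi => (h `|t| xi * rhat Rhat xi)%:E))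
    (Rhat_density : exists A, trace_density Rhat A)
    (Rhat_hermitian :
      {ae spectral_trace_measure Rhat, forall xi, hermitian_mx (Rhat xi)})
    (Rhat_nonneg :
      {ae spectral_trace_measure Rhat,
        forall xi, nonneg_definite_mx (Rhat xi)}) :
  (forall N : nat, (0 < N)%N ->
    forall (alpha : 'I_N -> R[i]) (t : 'I_N -> R),
    {ae spectral_trace_measure Rhat, forall xi,
      0 <= \sum_(p < N) \sum_(q < N)
             (h `|t p - t q| xi)%:C * alpha p * (alpha q)^*})
  <-> nonneg_definite_fun (spectral_covariance Rhat h).
Proof.
split; last by move=> Kpos N _ alpha t; exact: temporal_form_ae_ge0.
exact: covariance_nonneg_definite.
Qed.
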